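(* Let $G$ be a commutative group, $r$ a positive integer, $m\colon G\to\mathbb{C}$ an exponential, and let $a=(a_\alpha)_{\alpha\in\mathbb{N}^r}$ be a family of additive functions $a_\alpha\colon G\to\mathbb{C}$. For each $\alpha\in\mathbb{N}^r$ define $f_\alpha\colon G\to\mathbb{C}$ by $$f_\alpha(x)=B_\alpha(a(x))\,m(x)\qquad(x\in G),$$ where $a(x)=(a_\alpha(x))_{\alpha\in\mathbb{N}^r}$ and $B_\alpha$ denotes the multivariate Bell polynomial. Then $(f_\alpha)_{\alpha\in\mathbb{N}^r}$ is a generalized moment sequence of rank $r$ associated with the exponential $m$.
   Context: $\mathbb{N}$ is the set of nonnegative integers. Groups are written additively and carry the discrete topology (so every function is continuous). An exponential on $G$ is a function $m\colon G\to\mathbb{C}$, not identically zero, with $m(x+y)=m(x)m(y)$ for all $x,y\in G$. An additive function is a homomorphism $G\to(\mathbb{C},+)$. Multi-index notation for $\alpha,\beta\in\mathbb{N}^r$: $\alpha!=\prod_{k=1}^r\alpha_k!$, $|\alpha|=\sum_{k=1}^r\alpha_k$, $t^\alpha=\prod_{k=1}^r t_k^{\alpha_k}$, $\binom{\alpha}{\beta}=\prod_{k=1}^r\binom{\alpha_k}{\beta_k}$; $\beta\le\alpha$ means $\beta_k\le\alpha_k$ for all $k$; $\beta<\alpha$ means $\beta\le\alpha$ and $\beta\ne\alpha$. Generalized moment sequence of rank $r$: a family $(f_\alpha)_{\alpha\in\mathbb{N}^r}$ of functions $f_\alpha\colon G\to\mathbb{C}$ such that for all $\alpha\in\mathbb{N}^r$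 and all $x,y\in G$ $$f_\alpha(x+y)=\sum_{\beta\le\alpha}\binom{\alpha}{\beta}f_\beta(x)f_{\alpha-\beta}(y).$$ It is associated with the exponential $m$ if $f_0=m$, where $0=(0,\dots,0)\in\mathbb{N}^r$. Multivariate Bell polynomials: for variables $x=(x_\mu)_{\mu\in\mathbb{N}^r}$ and $\alpha\in\mathbb{N}^r$, $$B_\alpha(x)=\alpha!\sum\prod_{0<\mu\le\alpha}\frac{x_\mu^{c_\mu}}{c_\mu!\,(\mu!)^{c_\mu}},$$ where the sum runs over all families $(c_\mu)_{0<\mu\le\alpha}$ of nonnegative integers with $\sum_{0<\mu\le\alpha}c_\mu\,\mu=\alpha$. Equivalently, as formal power series in $t=(t_1,\dots,t_r)$, $\sum_{\alpha\in\mathbb{N}^r}B_\alpha(x)\frac{t^\alpha}{\alpha!}=\exp\Big(\sum_{|\mu|\ge1}x_\mu\frac{t^\mu}{\mu!}\Big)$. In particular $B_0=1$, and $B_\alpha$ does not depend on $x_0$. *)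

(* Defs.v *)
From HB Require Import structures.
From mathcomp Require Import all_boot all_order all_algebra.
From mathcomp Require Export reals complex.
From mathcomp Require Export mpoly.

Set Implicit Arguments.
Unset Strict Implicit.
Unset Printing Implicit Defensive.

Import GRing.Theory.
Local Open Scope ring_scope.

(* Multi-indices in N^r are the exponent vectors 'X_{1..r} of mpoly, with
   |alpha| = mdeg alpha, the pointwise order (b <= a)%MM and truncated
   pointwise subtraction (a - b)%MM. *)

Definition mfact (r : nat) (alpha : 'X_{1..r}) : nat :=
  (\prod_(k < r) (alpha k)`!)%N.

Definition mbinom (r : nat) (alpha beta : 'X_{1..r}) : nat :=
  (\prod_(k < r) 'C(alpha k, beta k))%N.

(* The bound on mdeg only makes the index type finite: it is implied by
   mu <= alpha. *)
Definition pos_subindex (r : nat) (alpha : 'X_{1..r}) : Type :=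
  {mu : 'X_{1..r < (mdeg alpha).+1} |
    (bmnm mu != 0%MM) && (bmnm mu <= alpha)%MM}.

HB.instance Definition _ (r : nat) (alpha : 'X_{1..r}) :=
  Finite.on (pos_subindex alpha).

Definition subindex_val (r : nat) (alpha : 'X_{1..r})
  (mu : pos_subindex alpha) : 'X_{1..r} := bmnm (val mu).

Coercion subindex_val : pos_subindex >-> multinom.

(* The families (c_mu) with sum_mu c_mu mu = alpha have all c_mu <= |alpha|,
   so summing over families with values in {0, ..., |alpha|} loses none. *)
Lemma bell_mult_le (r : nat) (alpha : 'X_{1..r})
    (c : pos_subindex alpha -> nat) :
  (\sum_(mu : pos_subindex alpha) (mu : 'X_{1..r}) *+ c mu)%MM = alpha ->
  forall mu : pos_subindex alpha, (c mu <= mdeg alpha)%N.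
Proof.
move=> defa mu; rewrite -[in X in (_ <= X)%N]defa.
rewrite mdeg_sum (bigD1 mu) //= mdegMn.
apply: leq_trans (leq_addr _ _); rewrite leq_pmull // lt0n mdeg_eq0.
by case/andP: (valP mu).
Qed.

Definition bell (F : numFieldType) (r : nat) (alpha : 'X_{1..r})
    (x : 'X_{1..r} -> F) : F :=
  (mfact alpha)%:R *
  \sum_(c : {ffun pos_subindex alpha -> 'I_(mdeg alpha).+1} |
        (\sum_(mu : pos_subindex alpha) (mu : 'X_{1..r}) *+ c mu)%MM == alpha)
    \prod_(mu : pos_subindex alpha)
      (x mu ^+ c mu / ((c mu)`!%:R * (mfact mu)%:R ^+ c mu)).

Definition exponential (K : pzRingType) (G : zmodType) (m : G -> K) : Prop :=
  (exists x, m x != 0) /\ (forall x y, m (x + y) = m x * m y).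

Definition generalized_moment_sequence (K : pzRingType) (G : zmodType)
    (r : nat) (f : 'X_{1..r} -> G -> K) : Prop :=
  forall (alpha : 'X_{1..r}) (x y : G),
    f alpha (x + y) =
    \sum_(beta : 'X_{1..r < (mdeg alpha).+1} | (bmnm beta <= alpha)%MM)
      (mbinom alpha beta)%:R * f beta x * f (alpha - beta)%MM y.

Definition associated_with (K : pzRingType) (G : zmodType) (r : nat)
    (f : 'X_{1..r} -> G -> K) (m : G -> K) : Prop :=
  f 0%MM =1 m.

(* Main.v *)
(**
  At all indices <= alpha, the power series exp(sum_mu x_mu t^mu / mu!) has the
  same coefficients as the product, over the finitely many 0 < mu <= alpha, of
  exponentials of x_mu t^mu / mu! truncated at order |alpha|, and the one at
  alpha is B_alpha(x) / alpha!.  Coefficients at indices <= beta are insensitive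
  both to raising the truncation order and to factors with mu not below beta, so
  a single product serves all beta <= alpha.  Since exp turns sums into
  products, comparing coefficients at alpha of the products for x, y and x + y
  gives the binomial identity for the Bell polynomials.
*)
Require Import Defs.
From mathcomp Require Import all_boot all_order all_algebra.
From mathcomp Require Import ring.

Local Open Scope ring_scope.

Set Implicit Arguments.
Unset Strict Implicit.
Unset Printing Implicit Defensive.

Import GRing.Theory Num.Theory.

Section TruncatedExp.
Variable F : numFieldType.

Definition texp (n : nat) (u : F) : {poly F} :=
  \poly_(i < n.+1) (u ^+ i / i`!%:R).

Lemma coef_texp n u k :
  (k <= n)%N -> (texp n u)`_k = u ^+ k / k`!%:R.
Proof. by rewrite coef_poly ltnS => ->. Qed.

(** This is the binomial theorem divided by [k!]. The bound on [k] matters: above degree [n] the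
    product carries incomplete convolution sums. *)
Lemma coef_texpD n u v k : (k <= n)%N ->
  (texp n (u + v))`_k = (texp n u * texp n v)`_k.
Proof.
move=> lekn; rewrite coef_texp // coefM addrC exprDn mulr_suml.
apply: eq_bigr => i _; have leik : (i <= k)%N by rewrite -ltnS.
rewrite !coef_texp ?(leq_trans leik) ?(leq_trans (leq_subr _ _)) //.
have f0 j : j`!%:R != 0 :> F by rewrite pnatr_eq0 -lt0n fact_gt0.
rewrite -(bin_fact leik) !natrM -mulr_natr.
have b0 : 'C(k, i)%:R != 0 :> F by rewrite pnatr_eq0 -lt0n bin_gt0.
by field; rewrite b0 !f0.
Qed.

End TruncatedExp.

Section BellGenerating.
Variables (F : numFieldType) (r : nat).
Implicit Types (alpha beta mu : 'X_{1..r}) (p q : {poly F}).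
Implicit Types (P Q : {mpoly F[r]}) (x y : 'X_{1..r} -> F).

(** Congruence modulo the span of the monomials whose exponent is not below [alpha]; that span is an
    ideal, which makes the relation multiplicative. *)
Definition eq_below alpha P Q :=
  forall beta, (beta <= alpha)%MM -> P@_beta = Q@_beta.

Lemma eq_belowM alpha P P' Q Q' :
  eq_below alpha P P' -> eq_below alpha Q Q' ->
  eq_below alpha (P * Q) (P' * Q').
Proof.
move=> eqPP' eqQQ' beta leba; rewrite !mcoeffM; apply: eq_bigr => k /eqP def_b.
move: leba; rewrite [X in (X <= _)%MM]def_b => leka.
by rewrite eqPP' ?eqQQ' // (lepm_trans _ leka) ?lem_addr ?lem_addl.
Qed.

Lemma eq_below_prod alpha (s : seq 'X_{1..r})
    (P Q : 'X_{1..r} -> {mpoly F[r]}) :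
  {in s, forall mu, eq_below alpha (P mu) (Q mu)} ->
  eq_below alpha (\prod_(mu <- s) P mu) (\prod_(mu <- s) Q mu).
Proof.
elim: s => [|mu s IHs] eqPQ; first by rewrite !big_nil.
rewrite !big_cons; apply: eq_belowM; first by apply: eqPQ; rewrite mem_head.
by apply: IHs => nu s_nu; apply: eqPQ; rewrite inE s_nu orbT.
Qed.

Lemma mcoeff_horner_alg mu p beta :
  (horner_alg 'X_[mu] p : {mpoly F[r]})@_beta =
  \sum_(i < size p) p`_i * ((mu *+ i)%MM == beta)%:R.
Proof.
rewrite -{1}[p]coefK poly_def linear_sum raddf_sum /=; apply: eq_bigr => i _.
by rewrite linearZ rmorphXn /= horner_algX mulr_algl mcoeffZ mcoeffXn.
Qed.

Lemma mdeg_le_mulm mu i : mu != 0%MM -> (i <= mdeg (mu *+ i)%MM)%N.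
Proof. by move=> mu0; rewrite mdegMn leq_pmull // lt0n mdeg_eq0. Qed.

Lemma mdeg_lepm alpha beta : (beta <= alpha)%MM -> (mdeg beta <= mdeg alpha)%N.
Proof. by move=> leba; rewrite -(submK leba) mdegD leq_addl. Qed.

(** Since [mu] is nonzero, the term of order [i] lands on a monomial of degree at least [i], so
    orders above [mdeg alpha] cannot reach an index below [alpha]. *)
Lemma eq_below_horner_alg alpha mu p q : mu != 0%MM ->
  (forall k, (k <= mdeg alpha)%N -> p`_k = q`_k) ->
  eq_below alpha (horner_alg 'X_[mu] p) (horner_alg 'X_[mu] q).
Proof.
move=> mu0 eqpq beta leba; apply/eqP; rewrite -subr_eq0 -mcoeffB -rmorphB /=.
rewrite mcoeff_horner_alg big1 // => i _; rewrite coefB.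
case: eqP => [defb|_]; last by rewrite mulr0.
rewrite eqpq ?subrr ?mul0r // (leq_trans _ (mdeg_lepm leba)) // -defb.
exact: mdeg_le_mulm.
Qed.

(** Every term beyond the constant one is a multiple of ['X_[mu]], hence invisible below [alpha]. *)
Lemma eq_below_horner_alg1 alpha mu p : ~~ (mu <= alpha)%MM -> p`_0 = 1 ->
  eq_below alpha (horner_alg 'X_[mu] p) 1.
Proof.
move=> nlema p0 beta leba; apply/eqP; rewrite -subr_eq0 -mcoeffB.
rewrite -(rmorph1 (horner_alg 'X_[mu])) -rmorphB mcoeff_horner_alg big1 //.
move=> [[|i] _] _ /=; first by rewrite coefB p0 coef1 subrr mul0r.
case: eqP => [defb|_]; last by rewrite mulr0.
case/negP: nlema; apply: lepm_trans leba; rewrite -defb mulmS; exact: lem_addr.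
Qed.

Definition bell_factor n x mu : {mpoly F[r]} :=
  horner_alg 'X_[mu] (texp n (x mu / (mfact mu)%:R)).

Definition subindices alpha : seq 'X_{1..r} :=
  [seq subindex_val mu | mu : pos_subindex alpha].

Definition bell_poly alpha x : {mpoly F[r]} :=
  \prod_(mu <- subindices alpha) bell_factor (mdeg alpha) x mu.

Lemma mem_subindices alpha mu :
  (mu \in subindices alpha) = (mu != 0%MM) && (mu <= alpha)%MM.
Proof.
apply/mapP/idP => [[nu _ ->]|mu_ok]; first exact: (valP nu).
have lt_mu : (mdeg mu < (mdeg alpha).+1)%N.
  by rewrite ltnS; case/andP: mu_ok => _ /mdeg_lepm.
exists (exist _ (BMultinom lt_mu) mu_ok : pos_subindex alpha) => //.
exact: mem_enum.
Qed.

Lemma subindices_uniq alpha : uniq (subindices alpha).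
Proof.
rewrite map_inj_uniq ?enum_uniq // => mu nu eq_munu.
by apply/val_inj/val_inj.
Qed.

Lemma subindices_filter alpha beta : (beta <= alpha)%MM ->
  perm_eq (subindices beta) [seq mu <- subindices alpha | (mu <= beta)%MM].
Proof.
move=> leba; apply: uniq_perm; rewrite ?filter_uniq ?subindices_uniq // => mu.
rewrite mem_filter !mem_subindices andbCA; case: (mu != 0%MM) => //=.
by apply/idP/andP => [lemb|[]//]; split=> //; apply: lepm_trans leba.
Qed.

Lemma bell_poly_below alpha beta x : (beta <= alpha)%MM ->
  eq_below beta (bell_poly beta x) (bell_poly alpha x).
Proof.
move=> leba; rewrite /bell_poly (perm_big _ (subindices_filter leba)) big_filter.
(* Indices not below [beta] now contribute a factor 1, so both products run over [subindices alpha]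
   and compare factor by factor. *)
rewrite big_mkcond; apply: eq_below_prod => mu; rewrite mem_subindices.
case/andP=> mu0 _; case: ifP => [_|/negbT nlemb].
  apply: eq_below_horner_alg => // k lekb.
  by rewrite !coef_texp // (leq_trans lekb) ?mdeg_lepm.
move=> gamma leg; apply/esym; apply: eq_below_horner_alg1 leg => //.
by rewrite coef_texp // expr0 fact0 divr1.
Qed.

Lemma bell_polyD alpha x y :
  eq_below alpha (bell_poly alpha (fun mu => x mu + y mu))
                 (bell_poly alpha x * bell_poly alpha y).
Proof.
rewrite /bell_poly -big_split; apply: eq_below_prod => mu.
rewrite mem_subindices => /andP[mu0 _]; rewrite /= -rmorphM.
by apply: eq_below_horner_alg => // k lek; rewrite mulrDl coef_texpD.
Qed.

Lemma bellE alpha x :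
  bell alpha x = (mfact alpha)%:R * (bell_poly alpha x)@_alpha.
Proof.
rewrite /bell /bell_poly big_image /=; congr (_ * _).
have factorE mu : bell_factor (mdeg alpha) x mu =
    \sum_(i < (mdeg alpha).+1)
      (x mu ^+ i / (i`!%:R * (mfact mu)%:R ^+ i)) *: 'X_[mu *+ i].
  rewrite /bell_factor /texp poly_def linear_sum; apply: eq_bigr => i _.
  rewrite linearZ rmorphXn /= horner_algX mulr_algl mpolyXn; congr (_ *: _).
  by rewrite expr_div_n invfM mulrAC mulrA.
under [in RHS]eq_bigr do rewrite factorE.
(* Expanding the product picks one order [c mu] in each factor; these choices are exactly the
   families in [bell], and extracting the coefficient at [alpha] imposes the condition on their
   sum. *)
rewrite bigA_distr_bigA raddf_sum [LHS]big_mkcond; apply: eq_bigr => c _ /=.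
rewrite scaler_prod -(big_morph _ (@mpolyXD r F) (@mpolyX0 r F)).
rewrite mcoeffZ mcoeffX.
by case: eqP; rewrite ?mulr1 ?mulr0.
Qed.

Lemma mbinom_fact alpha beta : (beta <= alpha)%MM ->
  (mbinom alpha beta * mfact beta * mfact (alpha - beta)%MM = mfact alpha)%N.
Proof.
move=> /mnm_lepP leba; rewrite /mbinom /mfact -!big_split.
by apply: eq_bigr => k _ /=; rewrite mnmBE -mulnA bin_fact.
Qed.

Lemma bellD alpha x y :
  bell alpha (fun mu => x mu + y mu) =
  \sum_(beta : 'X_{1..r < (mdeg alpha).+1} | (bmnm beta <= alpha)%MM)
    (mbinom alpha beta)%:R * bell beta x * bell (alpha - beta)%MM y.
Proof.
rewrite bellE bell_polyD ?lepm_refl //.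
rewrite [(_ * _)@__](mcoeff_poly_mul_lin _ _ (ltnSn _)) mulr_sumr.
apply: eq_bigr => beta leba; have lesa := lem_subr alpha beta.
rewrite !bellE -(mbinom_fact leba) !natrM -!mulrA; congr (_ * (_ * _)).
(* The convolution takes coefficients of the products built for [alpha], while [bellE] gives those
   built for [beta] and [alpha - beta]; they agree at these indices. *)
rewrite (bell_poly_below x leba) ?(bell_poly_below y lesa) ?lepm_refl //.
exact: mulrCA.
Qed.

Lemma bell0 x : bell 0%MM x = 1.
Proof.
rewrite bellE /bell_poly big_seq big1 ?mcoeff1 => [|mu]; last first.
  rewrite mem_subindices => /andP[/negP mu0 /mdeg_lepm].
  by rewrite mdeg0 leqn0 mdeg_eq0.
by rewrite eqxx mulr1 /mfact big1 // => k _; rewrite mnm0E.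
Qed.

End BellGenerating.

Theorem proposition3 (R : realType) (G : zmodType) (r : nat) (hr : (0 < r)%N)
    (m : G -> R[i]) (hm : exponential m)
    (a : 'X_{1..r} -> {additive G -> R[i]}) :
  let f : 'X_{1..r} -> G -> R[i] :=
    fun alpha x => bell alpha (fun mu => a mu x) * m x in
  generalized_moment_sequence f /\ associated_with f m.
Proof.
move=> f; split=> [alpha x y|x]; last by rewrite /f bell0 mul1r.
(* The two families agree only pointwise, so additivity is applied inside the sum and product
   defining [bell]. *)
have aD : bell alpha (fun mu => a mu (x + y)) =
          bell alpha (fun mu => a mu x + a mu y).
  by congr (_ * _); apply: eq_bigr => c _; apply: eq_bigr => mu _; rewrite raddfD.
rewrite /f aD bellD hm.2 mulr_suml; apply: eq_bigr => beta _.
by rewrite mulrACA !mulrA.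
Qed.
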